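(* For a positive integer $n$, let $A$ and $B$ be independent random $n$-sided dice in the balanced sequences model. Then the probability that $A$ ties with $B$ is $o(1)$ as $n\to\infty$.
   Context: An $n$-sided die in the balanced sequences model is a sequence $(a_1,\dots,a_n)\in\{1,2,\dots,n\}^n$ with $\sum_i a_i=n(n+1)/2$; a random $n$-sided die is such a sequence chosen uniformly at random. For dice $A=(a_1,\dots,a_n)$ and $B=(b_1,\dots,b_n)$, $A$ beats $B$ if the number of pairs $(i,j)$ with $a_i>b_j$ is greater than the number of pairs $(i,j)$ with $a_i<b_j$; $A$ ties with $B$ if these two numbers are equal. *)

(* Defs.v *)
From mathcomp Require Import all_boot all_order all_algebra.
From mathcomp Require Import all_classical all_reals all_analysis.

Set Implicit Arguments.
Unset Strict Implicit.
Unset Printing Implicit Defensive.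

Import Order.TTheory GRing.Theory Num.Theory.
Import numFieldNormedType.Exports.
Local Open Scope ring_scope.

(* A sequence in {1, ..., n}^n; the element k of 'I_n encodes the face k + 1. *)
Definition faces (n : nat) := {ffun 'I_n -> 'I_n}.

Definition face (n : nat) (A : faces n) (i : 'I_n) : nat := (A i).+1.

(* n * (n + 1) is even, so the truncated division is exact. *)
Definition dice (n : nat) : {set faces n} :=
  [set A : faces n | (\sum_(i < n) face A i == (n * n.+1) %/ 2)%N].

Definition ties (n : nat) (A B : faces n) : bool :=
  #|[set p : 'I_n * 'I_n | (face A p.1 > face B p.2)%N]|
    == #|[set p : 'I_n * 'I_n | (face A p.1 < face B p.2)%N]|.

(* Probability mass function of the uniform distribution on [dice n]. *)
Definition die_pmf (R : realType) (n : nat) (A : faces n) : R :=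
  if A \in dice n then (#|dice n|%:R)^-1 else 0.

(* By independence the joint mass function of (A, B) is the product. *)
Definition tie_probability (R : realType) (n : nat) : R :=
  \sum_(A : faces n) \sum_(B : faces n | ties A B) die_pmf R A * die_pmf R B.

(* Main.v *)
Require Import Defs.
From mathcomp Require Import all_boot all_order all_algebra.
From mathcomp Require Import all_classical all_reals all_analysis.
From mathcomp Require Import zify.

(** Cut a die into [n./2] pairs of faces (and one more face if [n] is odd), and
    let [score A v] be the number of faces of [A] below [v] minus the number of
    faces above [v]; then [A] ties [B] iff the scores of the faces of [B] sum
    to 0.

    Fix [M] and a step [D] proportional to [n / M].  If some pair of [B] lies
    in one of the [M] cells [[jD, (j+1)D) x [n-(j+1)D, n-jD)], translating the
    first such pair by the vectors [(iD, -iD)] from cell to cell partitions the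
    dice into blocks of size [M].  If [A] ties two members of a block, then
    [score A x1 + score A y1 = score A x2 + score A y2] for explicit
    [x1 < x2 < y2 < y1], with [y1 - y2 = x2 - x1].  Translating a pair of faces
    of [A] that lie just above [x2] by [(-D, D)] preserves the sum of the faces
    and changes the difference of the two sides by exactly 2.  When [A] has at
    least [m] such pairs, the pairs can be flipped independently, so that the
    equality has conditional probability at most [max_e 'C(m, e) / 2 ^ m].
    Hence ties have probability at most about [1 / M].

    Each exceptional event has exponentially small probability for independent
    uniform faces, while dice form at least a fraction [n ^ -5] of all
    sequences: some sum is taken by at least [n ^ N / n ^ 2] of the sequences of
    length [N = n./2], and appending to one such sequence the reflection of
    another one gives a die. *)

Set Implicit Arguments.
Unset Strict Implicit.
Unset Printing Implicit Defensive.

Import Order.TTheory GRing.Theory Num.Theory.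
Import numFieldNormedType.Exports.

(** * Numerical estimates *)

Lemma bin_le_succ m j : j.*2.+1 <= m -> 'C(m, j) <= 'C(m, j.+1).
Proof.
move=> jm; rewrite -(@leq_pmul2l j.+1) // mul_bin_left leq_mul2r.
by apply/orP; right; lia.
Qed.

Lemma bin_le_central k j : 'C(k.*2, j) <= 'C(k.*2, k).
Proof.
have low i d : i + d <= k -> 'C(k.*2, i) <= 'C(k.*2, i + d).
  elim: d => [|d IH] h; first by rewrite addn0.
  apply: leq_trans (IH _) _; first by lia.
  by rewrite addnS bin_le_succ //; lia.
have [jk|kj] := leqP j k; first by have := low j (k - j); rewrite subnKC //; apply.
have [jk|jk] := leqP j k.*2; last by rewrite bin_small.
rewrite -bin_sub //; have := low (k.*2 - j) (j - k).
have -> : k.*2 - j + (j - k) = k by lia.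
by apply; lia.
Qed.

(** Induction on [k]: consecutive central coefficients have quotient [2(2k+1)/(k+1)], and
    [(2k+1)(2k+3) <= (2k+2)^2]. *)
Lemma central_bin_sq_le k : 'C(k.*2, k) ^ 2 * k.*2.+1 <= 16 ^ k.
Proof.
elim: k => [|k IH]; first by rewrite bin0.
have E : k.+1 * 'C(k.+1.*2, k.+1) = 2 * k.*2.+1 * 'C(k.*2, k).
  have e1 : k.+1 * 'C(k.*2.+2, k.+1) = k.*2.+2 * 'C(k.*2.+1, k).
    by rewrite -mul_bin_diag.
  have e2 : k.+1 * 'C(k.*2.+1, k) = k.*2.+1 * 'C(k.*2, k).
    have := mul_bin_down k.*2.+1 k; rewrite /=.
    by have -> : k.*2.+1 - k = k.+1 by lia.
  have : k.+1 * (k.+1 * 'C(k.*2.+2, k.+1)) = k.+1 * (2 * k.*2.+1 * 'C(k.*2, k)).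
    by rewrite e1 mulnCA e2; nia.
  by move/eqP; rewrite eqn_pmul2l // => /eqP.
rewrite -(@leq_pmul2l (k.+1 ^ 2)) // mulnA -expnMn E.
rewrite !expnMn (expnS 16).
have h : (2 ^ 2 * k.*2.+1 ^ 2) * k.+1.*2.+1 <= k.+1 ^ 2 * 16 * k.*2.+1.
  by rewrite doubleS -!mul2n; nia.
set c := 'C(_, _) ^ 2 in IH *.
apply: leq_trans (_ : k.+1 ^ 2 * 16 * (c * k.*2.+1) <= _).
  by move: (leq_mul (leqnn c) h); rewrite -!mul2n; lia.
by rewrite -mulnA leq_mul2l; apply/orP; right; rewrite leq_mul2l IH orbT.
Qed.

(** The central coefficient settles even [m], and Pascal's rule reduces odd [m] to it. Thus [m] fair
    coins show a prescribed number of heads with probability at most [1 / L]. *)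
Lemma bin_anticoncentration L m j : L ^ 2 < m -> L * 'C(m, j) <= 2 ^ m.
Proof.
have ev k i : L ^ 2 <= k.*2.+1 -> L * 'C(k.*2, i) <= 2 ^ k.*2.
  move=> Lk; apply: leq_trans (_ : L * 'C(k.*2, k) <= _).
    by rewrite leq_mul2l bin_le_central orbT.
  rewrite -(@leq_exp2r _ _ 2) // expnMn -expnM.
  have -> : 2 ^ (k.*2 * 2) = 16 ^ k by rewrite -mul2n (_ : 2 * k * 2 = 4 * k) ?expnM //; lia.
  by apply: leq_trans (central_bin_sq_le k); rewrite mulnC leq_mul2l Lk orbT.
rewrite -(odd_double_half m); case: (odd m) => /= Lm; last by apply: ev; lia.
rewrite add1n expnS; case: j => [|j].
  by have := ev m./2 0 ltac:(lia); rewrite !bin0; lia.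
rewrite binS.
have := ev m./2 j ltac:(lia); have := ev m./2 j.+1 ltac:(lia); lia.
Qed.

(** Bernoulli's inequality for the exponent [N %/ 6], raised to the sixth power, yields a factor of
    degree 6, which absorbs [C * n ^ 5]. *)
Lemma exp_growth C q :
  exists n0, forall n, n0 <= n -> C * n ^ 5 * q ^ n./2 <= q.+1 ^ n./2.
Proof.
have bern j : j * q ^ j <= q * q.+1 ^ j.
  suff : (q + j) * q ^ j <= q * q.+1 ^ j by lia.
  elim: j => [|j IH]; first by rewrite addn0 !expn0.
  by rewrite !expnS; nia.
(* For [1 <= j], [n < 12 (j + 1) <= 24 j]. *)
have [c cE] : exists c, c = 24 by eexists.
have [k0 k0E] : exists k0, k0 = (c * q) ^ 6 by eexists.
exists (26 + C * k0) => n hn.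
have n_gt0 : 0 < n by lia.
set N := n./2; pose j := N %/ 6; pose r := N %% 6.
have NE : N = j * 6 + r by rewrite /j /r; lia.
have b6 : j ^ 6 * q ^ N <= q ^ 6 * q.+1 ^ N.
  rewrite NE !expnD !expnM (mulnA (j ^ 6)) (mulnA (q ^ 6)).
  rewrite -!expnMn leq_mul //.
    by rewrite leq_exp2r.
  by rewrite /r; case: (N %% 6) => // s; rewrite leq_exp2r.
have jn : n ^ 6 <= (c * j) ^ 6.
  by rewrite leq_exp2r // /j /N; lia.
have key : n ^ 6 * q ^ N <= k0 * q.+1 ^ N.
  apply: leq_trans (leq_mul jn (leqnn _)) _.
  by rewrite k0E !expnMn -!(mulnA (c ^ 6)) leq_mul2l b6 orbT.
have [k00|k0_gt0] := posnP k0.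
  move: key; rewrite k00 mul0n leqn0 muln_eq0 expn_eq0 /= eqn0Ngt n_gt0 /=.
  by move=> /eqP ->; rewrite muln0.
rewrite -(@leq_pmul2l k0) //; apply: leq_trans key.
rewrite (expnS n 5) (mulnA k0) leq_mul2r (mulnA k0) leq_mul2r.
by apply/orP; right; apply/orP; right; lia.
Qed.

(** * Dice as families of pairs *)

Definition pdie (n : nat) : finType :=
  ({ffun 'I_(n./2) -> 'I_n * 'I_n} * {ffun 'I_(odd n) -> 'I_n})%type.

Definition psum (n : nat) (f : 'I_n -> int) (p : pdie n) : int :=
  (\sum_k (f (p.1 k).1 + f (p.1 k).2) + \sum_j f (p.2 j))%R.

(** Faces are numbered from 0 here, so the required sum is [n(n+1)/2 - n]. *)
Definition pdice (n : nat) : {set pdie n} :=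
  [set p | psum (fun a => Posz a) p == Posz ((n * n.-1) %/ 2)].

Definition active (n : nat) (P : pred ('I_n * 'I_n)) (p : pdie n) :=
  [set k | P (p.1 k)].

Lemma card_pdie n : #|pdie n| = n ^ n.
Proof.
rewrite card_prod !card_ffun card_prod !card_ord mulnn.
by rewrite -expnM -expnD mul2n addnC odd_double_half.
Qed.

(* Markov's inequality for the moment generating function of the number of
   active pairs, at the point where each active pair has weight 1/2. *)
Lemma card_few_active n (P : pred ('I_n * 'I_n)) c m :
    0 < c -> n ^ 2 <= c * #|P| ->
  #|[set p : pdie n | #|active P p| < m]| * (2 * c) ^ n./2
    <= 2 ^ m * (2 * c).-1 ^ n./2 * n ^ n.
Proof.
move=> c_gt0 cP; set N := n./2.
(* The weights 1/2 and 1 are doubled to stay in [nat]. *)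
pose w (x : 'I_n * 'I_n) := if P x then 1 else 2.
have wsum : \sum_x w x + #|P| = 2 * n ^ 2.
  rewrite -sum1_card [X in _ + X]big_mkcond -big_split /=.
  rewrite (eq_bigr (fun _ => 2)) => [|x _]; last first.
    by rewrite /w -topredE /=; case: (P x).
  by rewrite sum_nat_const card_prod card_ord mulnC mulnn.
have total : \sum_(p : pdie n) \prod_k w (p.1 k) = (\sum_x w x) ^ N * n ^ odd n.
  rewrite -(pair_bigA _ (fun (f : {ffun 'I_N -> 'I_n * 'I_n})
                          (g : {ffun 'I_(odd n) -> 'I_n}) => \prod_k w (f k))) /=.
  under eq_bigr do rewrite sum_nat_const card_ffun !card_ord mulnC.
  rewrite -big_distrl /=; congr (_ * _).
  rewrite -(bigA_distr_bigA (fun _ : 'I_N => w)) /=.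
  by rewrite prod_nat_const card_ord.
have prodE (p : pdie n) : \prod_k w (p.1 k) * 2 ^ #|active P p| = 2 ^ N.
  rewrite -[X in _ * 2 ^ X]sum1_card expn_sum [X in _ * X]big_mkcond -big_split /=.
  rewrite (eq_bigr (fun _ => 2)) => [|k _]; first by rewrite prod_nat_const card_ord.
  by rewrite inE /w; case: (P _).
have bad : #|[set p : pdie n | #|active P p| < m]| * 2 ^ N
             <= 2 ^ m * \sum_(p : pdie n) \prod_k w (p.1 k).
  rewrite big_distrr -sum_nat_const /=.
  apply: leq_trans (_ : \sum_(p in [set p : pdie n | #|active P p| < m])
                          2 ^ m * \prod_k w (p.1 k) <= _); last first.
    by rewrite [X in _ <= X](bigID [in [set p : pdie n | #|active P p| < m]]) leq_addr.
  apply: leq_sum => p; rewrite inE => pm.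
  rewrite -(prodE p) mulnC leq_mul2r; apply/orP; right.
  by rewrite leq_exp2l // ltnW.
rewrite expnMn mulnA; apply: leq_trans (leq_mul bad (leqnn _)) _.
have -> : n ^ n = (n ^ 2) ^ N * n ^ odd n.
  by rewrite -expnM -expnD mul2n addnC odd_double_half.
rewrite total -!mulnA leq_mul2l; apply/orP; right.
rewrite [n ^ odd n * _]mulnC !mulnA leq_mul2r -!expnMn; apply/orP; right.
(* The mean weight is [2 - #|P| / n ^ 2], at most [(2c - 1) / c]. *)
have h : (\sum_x w x) * c <= (2 * c).-1 * n ^ 2.
  have := congr1 (muln c) wsum; rewrite mulnDr.
  have := cP; move: (\sum_x w x) (n ^ 2) => s t; nia.
by case: (N) => // N'; rewrite leq_exp2r.
Qed.

Lemma card_pdice_ge n : 0 < n -> n ^ n <= #|pdice n| * n ^ 5.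
Proof.
move=> n_gt0; set N := n./2.
pose F (t : 'I_(n * n)) := [set f : {ffun 'I_N -> 'I_n} | \sum_k f k == t :> nat].
(* Pigeonhole: the [n ^ N] half-sequences are spread over at most [n * n] sums. *)
have [t tF] : exists t, n ^ N <= #|F t| * (n * n).
  apply/existsP; rewrite -[X in is_true X]negbK negb_exists; apply/negP => /forallP H.
  have bnd (f : {ffun 'I_N -> 'I_n}) : \sum_k f k < n * n.
    apply: leq_ltn_trans (_ : N * n.-1 < _); last by rewrite /N; nia.
    rewrite -[N in N * _]card_ord -sum_nat_const; apply: leq_sum => k _.
    by have := ltn_ord (f k); lia.
  have S : \sum_t #|F t| = n ^ N.
    rewrite -[RHS](_ : #|{ffun 'I_N -> 'I_n}| = _); last by rewrite card_ffun !card_ord.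
    rewrite -sum1_card (partition_big (fun f => Ordinal (bnd f)) predT) //=.
    apply: eq_bigr => t _; rewrite -sum1_card; apply: eq_bigl => f.
    by rewrite inE -val_eqE.
  have : \sum_(t < n * n) (#|F t| * (n * n)) < \sum_(t < n * n) n ^ N.
    have o : 'I_(n * n) by exists 0; rewrite muln_gt0 n_gt0.
    rewrite (bigD1 o) // [X in _ < X](bigD1 o) //= -addSn leq_add //.
      by rewrite ltnNge H.
    by apply: leq_sum => i _; rewrite ltnW // ltnNge H.
  by rewrite -big_distrl /= S sum_nat_const card_ord mulnC ltnn.
(* The pairs will contribute [N * n.-1]; for odd [n] the middle face supplies the missing
   [n.-1 / 2]. *)
have mid_lt : n.-1./2 < n by lia.
pose mid := Ordinal mid_lt.
pose E (fg : {ffun 'I_N -> 'I_n} * {ffun 'I_N -> 'I_n}) : pdie n :=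
  ([ffun k => (fg.1 k, rev_ord (fg.2 k))], [ffun=> mid]).
have Einj : injective E.
  move=> [f g] [f' g'] [] /ffunP e.
  have e' k : (f k, rev_ord (g k)) = (f' k, rev_ord (g' k)).
    by have := e k; rewrite !ffunE.
  congr pair; apply/ffunP => k; first by case: (e' k).
  by apply: rev_ord_inj; have := congr1 snd (e' k).
have sub : E @: finset.setX (F t) (F t) \subset pdice n.
  apply/fintype.subsetP => _ /imsetP[[f g] fgP ->]; move: fgP.
  rewrite !inE /= => /andP[/eqP ft /eqP gt].
  rewrite /psum /=.
  under eq_bigr do rewrite ffunE /=.
  under [X in (_ + X)%R]eq_bigr do rewrite ffunE /=.
  rewrite big_split /= sumr_const card_ord.
  have -> : (\sum_(k < N) Posz (f k))%R = Posz t.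
    by rewrite -ft (big_morph Posz PoszD (erefl _)).
  have -> : (\sum_(k < N) Posz (n - (g k).+1))%R = (Posz (N * n.-1) - Posz t)%R.
    rewrite -gt (big_morph Posz PoszD (erefl _)) -[N in N * _]card_ord -sum_nat_const.
    rewrite (big_morph Posz PoszD (erefl _)) -sumrB; apply: eq_bigr => k _.
    by move: (ltn_ord (g k)); move: (nat_of_ord (g k)) => a an; rewrite -subzn; lia.
  have nE : n = odd n + N.*2 by rewrite odd_double_half.
  apply/eqP; rewrite pmulrn; case: (odd n) nE => /= nE; nia.
have : #|F t| ^ 2 <= #|pdice n|.
  by rewrite -mulnn -cardsX -(card_imset _ Einj) subset_leq_card.
move=> h; apply: leq_trans (leq_mul h (leqnn _)).
have := leq_mul tF tF.
have -> : n ^ N * n ^ N = n ^ N.*2 by rewrite -expnD addnn.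
move=> k; have -> : n ^ n = n ^ odd n * n ^ N.*2 by rewrite -expnD odd_double_half.
(* The unpaired face costs at most a factor [n], the squared pigeonhole bound costs [n ^ 4]. *)
apply: leq_trans (_ : n * n ^ N.*2 <= _).
  by rewrite leq_mul2r; apply/orP; right; case: (odd n); rewrite ?expn0 ?expn1.
apply: leq_trans (leq_mul (leqnn n) k) _.
by rewrite !expnS expn0; lia.
Qed.

(** * Anticoncentration of the score of the first die *)

Lemma psumD n (f g : 'I_n -> int) p :
  psum (fun a => f a + g a)%R p = (psum f p + psum g p)%R.
Proof.
rewrite /psum addrACA -!big_split /=; congr (_ + _)%R.
by apply: eq_bigr => k _; rewrite addrACA.
Qed.

Lemma psumN n (f : 'I_n -> int) p : psum (fun a => - f a)%R p = (- psum f p)%R.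
Proof.
rewrite /psum opprD -!sumrN; congr (_ + _)%R.
by apply: eq_bigr => k _; rewrite opprD.
Qed.

(** [A] is determined by its trace on [K] xored with [s], an [e]-subset of [K], together with its
    part outside [K], which is free. *)
Lemma card_set_xor_slice (T : finType) (K s : {set T}) e :
  #|[set A : {set T} | #|[set k in K | (k \in A) (+) (k \in s)]| == e]|
    <= 'C(#|K|, e) * 2 ^ (#|T| - #|K|).
Proof.
pose f (A : {set T}) := ([set k in K | (k \in A) (+) (k \in s)], A :\: K).
have finj : injective f.
  move=> A B [] /finset.setP eK /finset.setP eC; apply/finset.setP => k.
  have := eK k; have := eC k; rewrite !inE.
  by case: (k \in K) => //=; case: (k \in s); case: (k \in A); case: (k \in B).
rewrite -(card_imset _ finj) -cards_draws -(cardsC K) addKn.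
rewrite -card_powerset -cardsX; apply/subset_leq_card/fintype.subsetP.
move=> _ /imsetP[A Ae ->]; move: Ae; rewrite !inE /= => ->; rewrite andbT.
by apply/andP; split; apply/fintype.subsetP => k; rewrite !inE; case/andP.
Qed.

Section Flips.
Variables (n : nat) (flip : 'I_n * 'I_n -> 'I_n * 'I_n).
Variables (act st : pred ('I_n * 'I_n)) (H : 'I_n -> int).
Hypothesis flipK : involutive flip.
Hypothesis act_flip : forall x, act (flip x) = act x.
Hypothesis flip_inactive : forall x, ~~ act x -> flip x = x.
Hypothesis st_flip : forall x, act x -> st (flip x) = ~~ st x.
Hypothesis sum_flip : forall x, (flip x).1 + (flip x).2 = x.1 + x.2 :> nat.
Hypothesis H_flip : forall x, act x ->
  (H (flip x).1 + H (flip x).2 + Posz (2 * st (flip x))%N%N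
   = H x.1 + H x.2 + Posz (2 * st x)%N)%R.

Let flips (T : {set 'I_(n./2)}) (p : pdie n) : pdie n :=
  ([ffun k => if k \in T then flip (p.1 k) else p.1 k], p.2).

Let flipsK T : involutive (flips T).
Proof.
move=> [p r]; congr pair; apply/ffunP => k; rewrite !ffunE /=.
by case: (k \in T); rewrite ?flipK.
Qed.

Let active_flips T p : active act (flips T p) = active act p.
Proof.
by apply/finset.setP => k; rewrite !inE ffunE; case: ifP; rewrite ?act_flip.
Qed.

Let flips_pdice T p : (flips T p \in pdice n) = (p \in pdice n).
Proof.
rewrite !inE; congr (_ == _); congr (_ + _)%R; apply: eq_bigr => k _.
by rewrite ffunE; case: ifP => // _; rewrite -!PoszD sum_flip.
Qed.

Let ups p := [set k in active act p | st (p.1 k)].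

(** By [H_flip], every pair that changes state trades 2 units of [H] against one unit of [ups]. *)
Let psum_flips T p :
  (psum H (flips T p) + Posz (2 * #|ups (flips T p)|)%N
   = psum H p + Posz (2 * #|ups p|)%N)%R.
Proof.
have upsE q : Posz (2 * #|ups q|)
              = (\sum_k Posz (if act (q.1 k) then 2 * st (q.1 k) else 0)%N)%R.
  rewrite -sum1_card big_distrr (big_morph Posz PoszD (erefl _)) /= big_mkcond.
  by apply: eq_bigr => k _; rewrite !inE; case: (act _); case: (st _).
rewrite !upsE /psum addrAC [RHS]addrAC -!big_split /=.
congr (_ + _)%R; apply: eq_bigr => k _; rewrite ffunE; case: ifP => // _.
by rewrite act_flip; case: ifP => [/H_flip //|/negbT/flip_inactive ->].
Qed.

(** Double counting over [T] and [p]: each [flips T] permutes the dice and keeps the active set,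
    while for fixed [p] a uniform [T] makes the number of [ups] binomial, and [psum H = 0]
    prescribes that number. *)
Lemma flip_anticoncentration L m : L ^ 2 < m ->
  L * #|[set p in pdice n | (m <= #|active act p|) && (psum H p == 0%R)]|
    <= #|pdice n|.
Proof.
move=> Lm; set Z := [set p in _ | _].
pose good := [pred p | (p \in pdice n) && (m <= #|active act p|)].
have count p : good p ->
    L * #|[set T | psum H (flips T p) == 0%R]| <= 2 ^ n./2.
  move=> /andP[_ pm]; set K := active act p in pm.
  (* The only number of [ups] after flipping that is compatible with [psum H = 0]. *)
  pose e := (absz (psum H p + Posz (2 * #|ups p|)%N)%R)./2.
  have sub : [set T | psum H (flips T p) == 0%R] \subset
      [set T : {set 'I_(n./2)} |
        #|[set k in K | (k \in T) (+) (k \in [set k | st (p.1 k)])]| == e].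
    apply/fintype.subsetP => T; rewrite !inE => /eqP T0.
    have := psum_flips T p; rewrite T0 add0r => eT.
    have -> : [set k in K | (k \in T) (+) (k \in [set k | st (p.1 k)])]
              = ups (flips T p).
      apply/finset.setP => k; rewrite /ups active_flips !inE ffunE -/K.
      case: (boolP (act _)) => //= pk.
      by case: (k \in T); rewrite ?st_flip.
    by rewrite /e -eT; lia.
  apply: leq_trans (leq_mul (leqnn L) (subset_leq_card sub)) _.
  apply: leq_trans (leq_mul (leqnn L) (card_set_xor_slice _ _ _)) _.
  rewrite card_ord mulnA.
  apply: leq_trans (leq_mul (bin_anticoncentration e (leq_trans Lm pm)) (leqnn _)) _.
  rewrite -expnD subnKC // -[X in _ <= X]card_ord; exact: max_card.
have ZE T : #|Z| = \sum_(p | good p) (psum H (flips T p) == 0%R).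
  rewrite -sum1_card (reindex_inj (inv_inj (flipsK T))) /= big_mkcond.
  rewrite [RHS]big_mkcond; apply: eq_bigr => p _.
  rewrite /Z inE flips_pdice active_flips /good /=.
  by case: (p \in _); case: (m <= _); case: eqP.
rewrite -(@leq_pmul2l (2 ^ n./2)) ?expn_gt0 // mulnCA.
have -> : 2 ^ n./2 * #|Z| = \sum_(p | good p) #|[set T | psum H (flips T p) == 0%R]|.
  have -> : 2 ^ n./2 = #|{: {set 'I_(n./2)}}|.
    by rewrite -cardsT -powersetT card_powerset cardsT card_ord.
  rewrite -sum_nat_const (eq_bigr _ (fun T _ => ZE T)) exchange_big /=.
  apply: eq_bigr => p _; rewrite -sum1_card [RHS]big_mkcond /=.
  by apply: eq_bigr => T _; rewrite inE; case: eqP.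
rewrite big_distrr /=.
apply: leq_trans (_ : \sum_(p | good p) 2 ^ n./2 <= _); first exact: leq_sum.
rewrite sum_nat_const mulnC leq_mul2l; apply/orP; right.
by apply/subset_leq_card/fintype.subsetP => p /andP[].
Qed.

End Flips.

(** The sign of [v - a]. *)
Definition sg (a v : nat) : int := (Posz (a < v) - Posz (v < a))%R.

Definition score n (p : pdie n) (v : nat) : int := psum (fun a : 'I_n => sg a v) p.

Definition inner (D z : nat) n (x : 'I_n * 'I_n) : bool :=
  (z < x.1 < z + D) && (z < x.2 < z + D).
(** The image of [inner] under translation by [(-D, D)]; writing [x.1 + D] avoids truncated
    subtraction. *)
Definition outer (D z : nat) n (x : 'I_n * 'I_n) : bool :=
  (z < x.1 + D) && (x.1 < z) && (z + D < x.2 < z + D + D).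

(** The hypotheses of [collision_bound] keep the moved faces in range, so there the defaults of
    [insubd] are never taken. *)
Definition cross_flip (D z : nat) n (x : 'I_n * 'I_n) : 'I_n * 'I_n :=
  if inner D z x then (insubd x.1 (x.1 - D), insubd x.2 (x.2 + D))
  else if outer D z x then (insubd x.1 (x.1 + D), insubd x.2 (x.2 - D))
  else x.

(** [H] vanishes strictly between [x2] and [y2] and is -2 strictly between [x1] and [x2]. An inner
    pair has both faces in the former interval, an outer pair only its second face, so a flip
    changes [psum H] by exactly 2. *)
Lemma collision_bound n D x1 x2 y1 y2 L m :
    x1 + D <= x2 -> x2 + D + D <= y2 -> y2 <= y1 < n -> L ^ 2 < m ->
  L * #|[set p in pdice n | (m <= #|active [pred x | inner D x2 x || outer D x2 x] p|)
          && (score p x1 + score p y1 == score p x2 + score p y2)%R]|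
    <= #|pdice n|.
Proof.
move=> hx hy hn Lm.
pose H (a : 'I_n) : int := (sg a x1 + sg a y1 - (sg a x2 + sg a y2))%R.
have HE p : psum H p = (score p x1 + score p y1 - (score p x2 + score p y2))%R.
  by rewrite /score -!psumD -psumN -psumD.
have inord (a : 'I_n) b : val (insubd a b) = if b < n then b else a.
  by rewrite val_insubd.
have flipE x : cross_flip D x2 x =
   if inner D x2 x then (insubd x.1 (x.1 - D), insubd x.2 (x.2 + D))
  else if outer D x2 x then (insubd x.1 (x.1 + D), insubd x.2 (x.2 - D))
  else x by [].
have innerP (x : 'I_n * 'I_n) : inner D x2 x ->
  [/\ outer D x2 (cross_flip D x2 x), inner D x2 (cross_flip D x2 x) = false,
      (cross_flip D x2 x).1 = x.1 - D :> nat & (cross_flip D x2 x).2 = x.2 + D :> nat].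
  move=> ix; have e1 : (cross_flip D x2 x).1 = x.1 - D :> nat.
    by rewrite flipE ix inord; have := ltn_ord x.1; case: ifP; lia.
  have e2 : (cross_flip D x2 x).2 = x.2 + D :> nat.
    by rewrite flipE ix inord; move: ix; rewrite /inner; case: ifP; lia.
  by rewrite /inner /outer e1 e2; move: ix; rewrite /inner; split=> //; lia.
have outerP (x : 'I_n * 'I_n) : outer D x2 x ->
  [/\ inner D x2 (cross_flip D x2 x), outer D x2 (cross_flip D x2 x) = false, inner D x2 x = false,
      (cross_flip D x2 x).1 = x.1 + D :> nat & (cross_flip D x2 x).2 = x.2 - D :> nat].
  move=> ox; have ix : inner D x2 x = false.
    by move: ox; rewrite /inner /outer; lia.
  have e1 : (cross_flip D x2 x).1 = x.1 + D :> nat.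
    by rewrite flipE ix ox inord; move: ox; rewrite /outer; case: ifP; lia.
  have e2 : (cross_flip D x2 x).2 = x.2 - D :> nat.
    by rewrite flipE ix ox inord; have := ltn_ord x.2; case: ifP; lia.
  by rewrite /inner /outer e1 e2; move: ox; rewrite /outer; split=> //; lia.
set act := [pred x | _].
have noneP x : ~~ act x -> cross_flip D x2 x = x.
  by rewrite /act /= negb_or flipE => /andP[/negbTE -> /negbTE ->].
have := @flip_anticoncentration n (@cross_flip D x2 n) act (@outer D x2 n) H _ _ noneP _ _ _ L m Lm.
rewrite (_ : [set p in pdice n | _ && (psum H p == 0%R)] =
             [set p in pdice n | (m <= #|active act p|) &&
               (score p x1 + score p y1 == score p x2 + score p y2)%R]); last first.
  by apply/finset.setP => p; rewrite !inE HE subr_eq0.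
apply.
- move=> x; case: (boolP (inner D x2 x)) => [ix|nix].
    have [ox _ e1 e2] := innerP _ ix; have [_ _ _ e3 e4] := outerP _ ox.
    by apply/eqP; rewrite -pair_eqE /= -!val_eqE /= e3 e4 e1 e2; move: ix; rewrite /inner; lia.
  case: (boolP (outer D x2 x)) => [ox|nox]; last first.
    by rewrite !noneP // /act /= negb_or ?nix ?nox.
  have [ix _ _ e1 e2] := outerP _ ox; have [_ _ e3 e4] := innerP _ ix.
  by apply/eqP; rewrite -pair_eqE /= -!val_eqE /= e3 e4 e1 e2; move: ox; rewrite /outer; lia.
- move=> x; case: (boolP (act x)) => [/orP[ix|ox]|nx].
  + by rewrite /act /=; have [-> -> _ _] := innerP _ ix.
  + by rewrite /act /=; have [-> -> _ _ _] := outerP _ ox.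
  + by rewrite noneP //; apply/negbTE.
- move=> x /orP[ix|ox].
    by have [-> _ _ _] := innerP _ ix; move: ix; rewrite /inner /outer; lia.
  by have [_ -> _ _ _] := outerP _ ox; rewrite ox.
- move=> x; case: (boolP (act x)) => [/orP[ix|ox]|/noneP -> //].
    by have [_ _ -> ->] := innerP _ ix; move: ix; rewrite /inner; lia.
  by have [_ _ _ -> ->] := outerP _ ox; move: ox; rewrite /outer; lia.
- have Hin x : inner D x2 x -> (H x.1 + H x.2 + Posz (2 * outer D x2 x)%N = 0)%R.
    by rewrite /inner /outer /H /sg; lia.
  have Hout x : outer D x2 x -> (H x.1 + H x.2 + Posz (2 * outer D x2 x)%N = 0)%R.
    by rewrite /outer /H /sg; lia.
  move=> x /orP[ix|ox].
    by have [ox _ _ _] := innerP _ ix; rewrite (Hin x) // (Hout _ ox).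
  by have [ix _ _ _ _] := outerP _ ox; rewrite (Hout x) // (Hin _ ix).
Qed.

(** * Resampling one pair of the second die *)

(** The exponential gain [((2c-1)/(2c)) ^ n./2] outweighs the factor [n ^ 5] lost in passing from
    all sequences to dice. *)
Lemma few_active_negligible C c m : 0 < c ->
  exists n0, forall n, n0 <= n -> forall P : pred ('I_n * 'I_n),
    n ^ 2 <= c * #|P| ->
  C * #|[set p : pdie n | #|active P p| < m]| <= #|pdice n|.
Proof.
move=> c_gt0; have [n0 n0P] := exp_growth (C * 2 ^ m) (2 * c).-1.
exists n0.+1 => n n0n P cP; set B := #|_|.
have := n0P n (ltnW n0n); rewrite prednK ?muln_gt0 // => growth.
have few := card_few_active m c_gt0 cP; rewrite -/B in few.
have many := card_pdice_ge (leq_ltn_trans (leq0n _) n0n).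
rewrite -(@leq_pmul2r ((2 * c) ^ n./2)) ?expn_gt0 ?muln_gt0 ?c_gt0 // -mulnA.
apply: leq_trans (leq_mul (leqnn C) few) _.
rewrite mulnA; apply: leq_trans (leq_mul (leqnn _) many) _.
apply: leq_trans (leq_mul (leqnn #|pdice n|) growth).
move: (2 ^ m) (_ ^ n./2) (n ^ 5) => a b d; lia.
Qed.

(** [S] splits into blocks with one member [mv q j] for each state [j]; exchanging the current state
    with the requested one, [h] is an involution of [S * J]. *)
Lemma sum_resample (X J : finType) (S : {set X}) (mv : X -> J -> X) (st : X -> J)
    (phi : X -> nat) :
    (forall q j, q \in S -> mv q j \in S) ->
    (forall q j, q \in S -> st (mv q j) = j) ->
    (forall q i j, q \in S -> mv (mv q i) j = mv q j) ->
    (forall q, q \in S -> mv q (st q) = q) ->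
  \sum_(q in S) \sum_j phi (mv q j) = #|J| * \sum_(q in S) phi q.
Proof.
move=> mvS stmv mvmv mvst.
pose h (x : X * J) := (mv x.1 x.2, st x.1).
rewrite big_distrr /= [RHS](eq_bigr (fun q => \sum_(j : J) phi q)); last first.
  by move=> q _; rewrite sum_nat_const.
rewrite !pair_big_dep /= (reindex_onto h h) /=; last first.
  by move=> [q j]; rewrite andbT /h /= => qS; rewrite mvmv // mvst // stmv.
apply: eq_big => [[q j]|[q j] /andP[_ /eqP e]] /=.
  rewrite !andbT /h /=; case: (boolP (q \in S)) => qS.
    by rewrite mvS // mvmv // mvst // stmv // eqxx.
  (* Outside [S], [h] cannot return to [q] through a point of [S], since [mv] preserves [S]. *)
  apply/negbTE/negP => /andP[mqS /eqP[e1 _]].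
  by move: qS; rewrite -e1 mvS.
by case: e => -> _.
Qed.

(** Pair the least element of [E] with each of the others. This reduces counting ties in a block to
    counting joint ties. *)
Lemma card_le_pairs M (E : pred 'I_M) :
  #|E| <= 1 + #|[set ij : 'I_M * 'I_M | [&& ij.1 < ij.2, E ij.1 & E ij.2]]|.
Proof.
case: (pickP E) => [j1 Ej1|E0]; last by rewrite (eq_card0 (A := E) E0).
case: (arg_minnP (fun j : 'I_M => val j) Ej1) => j0 Ej0 jmin.
rewrite (cardD1 j0) [j0 \in E]Ej0 leq_add2l.
have inj : injective (pair j0 : 'I_M -> 'I_M * 'I_M) by move=> i j [].
rewrite -(card_imset _ inj); apply/subset_leq_card/fintype.subsetP.
move=> _ /imsetP[j jE ->]; move: jE; rewrite !inE /= => /andP[jj0 Ej].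
by rewrite Ej0 [E j]Ej ltn_neqAle jmin // !andbT eq_sym.
Qed.

Lemma card_interval_ge n z d :
  z + d <= n -> d <= #|[set a : 'I_n | z <= a < z + d]|.
Proof.
move=> zd; have lt (i : 'I_d) : z + i < n by have := ltn_ord i; lia.
have inj : injective (fun i => Ordinal (lt i)).
  by move=> i j /(congr1 val) /= /addnI /val_inj.
rewrite -[d in d <= _]card_ord -(card_imset _ inj).
apply/subset_leq_card/fintype.subsetP => _ /imsetP[i _ ->]; rewrite inE /=.
by have := ltn_ord i; lia.
Qed.

Lemma card_rectangle_ge n (P : pred ('I_n * 'I_n)) z w d :
    z + d <= n -> w + d <= n ->
    (forall x : 'I_n * 'I_n, z <= x.1 < z + d -> w <= x.2 < w + d -> P x) ->
  d ^ 2 <= #|P|.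
Proof.
move=> zd wd HP; rewrite -mulnn.
apply: leq_trans (leq_mul (card_interval_ge zd) (card_interval_ge wd)) _.
rewrite -cardsX; apply/subset_leq_card/fintype.subsetP => x.
by rewrite !inE => /andP[]; apply: HP.
Qed.

Definition ptie n (p q : pdie n) := psum (fun b : 'I_n => score p b) q == 0%R.

Definition update n (q : pdie n) k0 x : pdie n :=
  ([ffun k => if k == k0 then x else q.1 k], q.2).

Lemma psum_update n (f : 'I_n -> int) q k0 x :
  (psum f (update q k0 x) + (f (q.1 k0).1 + f (q.1 k0).2)
   = psum f q + (f x.1 + f x.2))%R.
Proof.
rewrite /psum /= (bigD1 k0) //= [in RHS](bigD1 k0) //= ffunE eqxx.
rewrite [X in (_ + X + _ + _)%R = _](eq_bigr (fun k => f (q.1 k).1 + f (q.1 k).2)%R).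
  by move: (bigop _ _ _) (bigop _ _ _) => a b; lia.
by move=> k /negbTE kk0; rewrite ffunE kk0.
Qed.

Section Blocks.
Variables (n M D : nat).
Hypotheses (D_gt0 : 0 < D) (Dn : (2 * M.+1 + 2) * D <= n).

(** The second face is measured from the top by [rev_ord], so that moving to another cell changes
    both quotients equally and preserves the sum of the faces. *)
Definition celled (x : 'I_n * 'I_n) : bool :=
  (x.1 %/ D == rev_ord x.2 %/ D) && (x.1 %/ D < M.+1).

Definition shift (x : 'I_n * 'I_n) (j : 'I_M.+1) : 'I_n * 'I_n :=
  (insubd x.1 (x.1 %% D + j * D),
   rev_ord (insubd x.2 (rev_ord x.2 %% D + j * D))).

(** Ensures that [shift] never falls back on a default of [insubd]. *)
Lemma cell_lt a (j : 'I_M.+1) : a %% D + (j * D + D + D + D) <= n.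
Proof.
by have := ltn_pmod a D_gt0; have := ltn_ord j; nia.
Qed.

Lemma shift1 x j : (shift x j).1 = x.1 %% D + j * D :> nat.
Proof. by rewrite /= val_insubd; have := cell_lt x.1 j; case: ifP; lia. Qed.

Lemma rev_shift2 x j : rev_ord (shift x j).2 = rev_ord x.2 %% D + j * D :> nat.
Proof.
rewrite /shift rev_ordK val_insubd.
by have := cell_lt (rev_ord x.2) j; case: ifP; lia.
Qed.

Lemma cell_div a j : (a %% D + j * D) %/ D = j.
Proof. by rewrite addnC divnMDl // (divn_small (ltn_pmod a D_gt0)) addn0. Qed.

Lemma cell_mod a j : (a %% D + j * D) %% D = a %% D.
Proof. by rewrite addnC modnMDl modn_mod. Qed.

Lemma celled_shift x j : celled (shift x j).
Proof. by rewrite /celled rev_shift2 shift1 !cell_div eqxx ltn_ord. Qed.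

Lemma pair_ord_eq (x y : 'I_n * 'I_n) :
  x.1 = y.1 :> nat -> rev_ord x.2 = rev_ord y.2 :> nat -> x = y.
Proof.
case: x y => [a b] [c d] /= /val_inj -> h.
by congr pair; apply: rev_ord_inj; apply: val_inj.
Qed.

Lemma shift_shift x i j : shift (shift x i) j = shift x j.
Proof.
by apply: pair_ord_eq; rewrite ?rev_shift2 ?shift1 cell_mod.
Qed.

Definition cell (x : 'I_n * 'I_n) : 'I_M.+1 := inord (x.1 %/ D).

Lemma cell_shift x j : cell (shift x j) = j.
Proof. by rewrite /cell shift1 cell_div inord_val. Qed.

Lemma shift_cell x : celled x -> shift x (cell x) = x.
Proof.
move=> /andP[/eqP e lt]; apply: pair_ord_eq.
  by rewrite shift1 inordK // addnC -divn_eq.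
by rewrite rev_shift2 inordK // e addnC -divn_eq.
Qed.

Lemma sum_shift x j : celled x -> (shift x j).1 + (shift x j).2 = x.1 + x.2 :> nat.
Proof.
move=> xc; have [/eqP e _] := andP xc.
have e1 := shift1 x j; have e2 := rev_shift2 x j.
have d1 := divn_eq x.1 D; have d2 := divn_eq (rev_ord x.2) D.
rewrite -e in d2; move: e1 e2 d1 d2 => /=.
have := ltn_ord (shift x j).2; have := ltn_ord x.2.
move: (x.1 %/ D * D) (j * D) => u v; lia.
Qed.

Definition first_celled (q : pdie n) := [pick k | celled (q.1 k)].

Definition move_block (q : pdie n) (j : 'I_M.+1) : pdie n :=
  if first_celled q is Some k then update q k (shift (q.1 k) j) else q.

Definition block_state (q : pdie n) : 'I_M.+1 :=
  if first_celled q is Some k then cell (q.1 k) else ord0.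

Definition with_cell : {set pdie n} :=
  [set q in pdice n | 0 < #|active celled q|].

Lemma with_cellP q : q \in with_cell ->
  exists2 k, first_celled q = Some k & celled (q.1 k).
Proof.
rewrite inE => /andP[_ /card_gt0P[k]]; rewrite inE => qk.
rewrite /first_celled; case: pickP => [k' qk'|/(_ k)]; first by exists k'.
by rewrite qk.
Qed.

(** A shift alters no pair's celled status, so the whole block selects the same index. *)
Lemma first_celled_update q k j : first_celled q = Some k -> celled (q.1 k) ->
  first_celled (update q k (shift (q.1 k) j)) = Some k.
Proof.
move=> <- qk; apply: eq_pick => i; rewrite /= ffunE; case: eqP => // ->.
by rewrite celled_shift qk.
Qed.

Lemma move_blockE q k j : first_celled q = Some k ->
  move_block q j = update q k (shift (q.1 k) j).
Proof. by rewrite /move_block => ->. Qed.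

Lemma move_block_with_cell q j : q \in with_cell -> move_block q j \in with_cell.
Proof.
move=> qc; have [k qk ck] := with_cellP qc; rewrite (move_blockE j qk).
rewrite inE; apply/andP; split; last first.
  by apply/card_gt0P; exists k; rewrite inE ffunE eqxx celled_shift.
move: qc; rewrite !inE => /andP[/eqP <- _]; apply/eqP.
have := psum_update (fun a : 'I_n => Posz a) q k (shift (q.1 k) j).
by rewrite -!PoszD (sum_shift j ck) => /addIr.
Qed.

Lemma block_state_move q j : q \in with_cell -> block_state (move_block q j) = j.
Proof.
move=> qc; have [k qk ck] := with_cellP qc; rewrite (move_blockE j qk).
by rewrite /block_state first_celled_update // ffunE eqxx cell_shift.
Qed.

Lemma move_move q i j : q \in with_cell ->
  move_block (move_block q i) j = move_block q j.
Proof.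
move=> qc; have [k qk ck] := with_cellP qc; rewrite !(move_blockE _ qk).
rewrite (move_blockE _ (first_celled_update i qk ck)).
congr pair; apply/ffunP => l; rewrite !ffunE eqxx shift_shift.
by case: eqP.
Qed.

Lemma move_state q : q \in with_cell -> move_block q (block_state q) = q.
Proof.
move=> qc; have [k qk ck] := with_cellP qc; rewrite (move_blockE _ qk).
rewrite /block_state qk shift_cell // [RHS]surjective_pairing.
by congr pair; apply/ffunP => l; rewrite ffunE; case: eqP => // ->.
Qed.

(** Two cases, whence the factor 2: either [p] has fewer than [m] active pairs, or [collision_bound]
    applies to the two positions of the moved pair. *)
Lemma card_both_tie m q (i j : 'I_M.+1) :
    q \in with_cell -> i < j -> (M.+1 ^ 2) ^ 2 < m ->
    (forall z, z + D <= n -> M.+1 ^ 2 *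
       #|[set p : pdie n |
           #|active [pred x | inner D z x || outer D z x] p| < m]| <= #|pdice n|) ->
  M.+1 ^ 2 * #|[set p in pdice n | ptie p (move_block q i) && ptie p (move_block q j)]|
    <= 2 * #|pdice n|.
Proof.
move=> qc ij Lm few; have [k qk ck] := with_cellP qc.
rewrite !(move_blockE _ qk); set x := q.1 k.
set si := shift x i; set sj := shift x j.
have ei : si.1 = x.1 %% D + i * D :> nat := shift1 x i.
have ej : sj.1 = x.1 %% D + j * D :> nat := shift1 x j.
have ri : n - si.2.+1 = (n - x.2.+1) %% D + i * D := rev_shift2 x i.
have rj : n - sj.2.+1 = (n - x.2.+1) %% D + j * D := rev_shift2 x j.
have li := ltn_ord si.2; have lj := ltn_ord sj.2.
have x1D := ltn_pmod x.1 D_gt0; have x2D := ltn_pmod (n - x.2.+1) D_gt0.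
have jD : j * D + D <= M.+1 * D by rewrite -mulSnr leq_mul2r ltn_ord orbT.
have ijD : i * D + D <= j * D by rewrite -mulSnr leq_mul2r ij orbT.
have h1 : si.1 + D <= sj.1 by lia.
(* The two extra units of [D] in [Dn] separate the low cells from the high ones. *)
have h2 : sj.1 + D + D <= sj.2 by lia.
have h3 : sj.2 <= si.2 < n by lia.
have col := collision_bound h1 h2 h3 Lm.
have zn : sj.1 + D <= n by lia.
move: col (few sj.1 zn); set act := [pred _ | _].
set A := [set _ in _ | _]; set B := [set _ | _] => cA cB.
set S := [set _ in _ | _]; rewrite mul2n -addnn.
apply: leq_trans (leq_add cA cB); rewrite -mulnDr leq_mul2l; apply/orP; right.
apply: leq_trans (leq_card_setU A B).1; apply/subset_leq_card/fintype.subsetP => p.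
rewrite !inE => /andP[-> /andP[/eqP ti /eqP tj]] /=.
rewrite ltnNge; case: (m <= _) => //=; rewrite orbF.
(* Both moved dice agree with [q] off [k] and both tie [p], so their moved pairs have equal total
   score. *)
have ui := psum_update (fun b : 'I_n => score p b) q k si.
have uj := psum_update (fun b : 'I_n => score p b) q k sj.
rewrite ti in ui; rewrite tj in uj; rewrite ui in uj.
by apply/eqP; apply: addrI uj.
Qed.

(** In a block, ties number at most one plus the joint ties: summed over [p], [P + 2 * P]. Dice
    without a celled pair contribute the fourth [P]. *)
Lemma ties_le m :
    (M.+1 ^ 2) ^ 2 < m ->
    (forall z, z + D <= n -> M.+1 ^ 2 *
       #|[set p : pdie n |
           #|active [pred x | inner D z x || outer D z x] p| < m]| <= #|pdice n|) ->
    M.+1 * #|[set q : pdie n | #|active celled q| < 1]| <= #|pdice n| ->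
  M.+1 * \sum_(p in pdice n) \sum_(q in pdice n) ptie p q <= 4 * #|pdice n| ^ 2.
Proof.
move=> Lm fewA fewB; set P := #|pdice n|.
pose phi (q : pdie n) := #|[set p in pdice n | ptie p q]|.
have phiE q : phi q = \sum_(p in pdice n) ptie p q.
  rewrite /phi -sum1_card big_mkcond [RHS]big_mkcond; apply: eq_bigr => p _.
  by rewrite !inE; case: (_ == _); case: ptie.
rewrite exchange_big /= (eq_bigr phi) => [|q _]; last by rewrite phiE.
rewrite (bigID [pred q | 0 < #|active celled q|]) /= mulnDr.
have -> : 4 * P ^ 2 = 3 * P * P + P * P by rewrite -mulnn; lia.
apply: leq_add.
- rewrite (eq_bigl [in with_cell]) => [|q]; last by rewrite !inE.
  have := sum_resample phi move_block_with_cell block_state_move move_move move_state.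
  rewrite card_ord => <-.
  apply: leq_trans (_ : \sum_(q in with_cell) 3 * P <= _); last first.
    rewrite sum_nat_const mulnC leq_mul2l subset_leq_card ?orbT //.
    by apply/fintype.subsetP => q; rewrite inE => /andP[].
  apply: leq_sum => q qc.
  pose both p := [set ij : 'I_M.+1 * 'I_M.+1 | [&& ij.1 < ij.2,
     ptie p (move_block q ij.1) & ptie p (move_block q ij.2)]].
  apply: leq_trans (_ : \sum_(p in pdice n) (1 + #|both p|) <= _).
    under eq_bigr do rewrite phiE.
    rewrite exchange_big /=; apply: leq_sum => p _.
    apply: leq_trans (card_le_pairs (fun j => ptie p (move_block q j))).
    rewrite -sum1_card [X in _ <= X]big_mkcond /=; apply: leq_sum => j _.
    by rewrite unfold_in; case: ptie.
  rewrite big_split /= sum1_card mulSn leq_add2l.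
  have -> : \sum_(p in pdice n) #|both p| = \sum_(ij : 'I_M.+1 * 'I_M.+1 | ij.1 < ij.2)
      #|[set p in pdice n | ptie p (move_block q ij.1) && ptie p (move_block q ij.2)]|.
    under eq_bigr do rewrite -sum1_card.
    under [RHS]eq_bigr do rewrite -sum1_card.
    rewrite (exchange_big_dep [pred ij : 'I_M.+1 * 'I_M.+1 | ij.1 < ij.2]) /=.
      by apply: eq_bigr => ij lt; apply: eq_bigl => p; rewrite !inE lt.
    by move=> p ij _; rewrite inE => /and3P[].
  (* There are at most [M.+1 ^ 2] pairs [i < j]; this is why [L] was taken to be [M.+1 ^ 2]. *)
  rewrite -(@leq_pmul2l (M.+1 ^ 2)) ?expn_gt0 // big_distrr /=.
  apply: leq_trans (_ : \sum_(ij : 'I_M.+1 * 'I_M.+1 | ij.1 < ij.2) 2 * P <= _).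
    by apply: leq_sum => ij lt; apply: card_both_tie qc lt Lm fewA.
  rewrite sum_nat_const leq_mul2r; apply/orP; right.
  by apply: leq_trans (max_card _) _; rewrite card_prod card_ord mulnn.
- apply: leq_trans (leq_mul fewB (leqnn P)).
  rewrite -mulnA leq_mul2l /=; apply: leq_trans (_ : \sum_(q | #|active celled q| < 1) P <= _).
    apply: leq_trans (_ : \sum_(q in pdice n | ~~ (0 < #|active celled q|)) P <= _).
      apply: leq_sum => q _; apply/subset_leq_card/fintype.subsetP => p.
      by rewrite inE => /andP[].
    rewrite big_mkcond [X in _ <= X]big_mkcond /=; apply: leq_sum => q _.
    by rewrite -leqNgt ltnS; case: (_ \in _); case: (_ <= 0).
  by rewrite sum_nat_const; apply: leq_mul => //; rewrite subset_leq_card //;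
     apply/fintype.subsetP => q; rewrite inE.
Qed.

End Blocks.

Lemma ties_negligible M : exists n0, forall n, n0 <= n ->
  M.+1 * \sum_(p in pdice n) \sum_(q in pdice n) ptie p q <= 4 * #|pdice n| ^ 2.
Proof.
pose K := 2 * M.+1 + 2; pose m := ((M.+1 ^ 2) ^ 2).+1.
(* Both kinds of pairs will contain a square of side at least [D.-1], and [n <= 3 * K * D.-1] once
   [2 <= D]. *)
have c_gt0 : 0 < (3 * K) ^ 2 by rewrite expn_gt0.
have [n1 few1] := few_active_negligible (M.+1 ^ 2) m c_gt0.
have [n2 few2] := few_active_negligible M.+1 1 c_gt0.
exists (n1 + n2 + 2 * K) => n hn; pose D := n %/ K.
have K_gt0 : 0 < K by rewrite /K; lia.
have D2 : 2 <= D by rewrite leq_divRL //; lia.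
have KD : K * D <= n by rewrite mulnC leq_trunc_div.
have nK : n <= 3 * K * D.-1.
  have := ltn_ceil n K_gt0; rewrite -/D; nia.
have nc (P : pred ('I_n * 'I_n)) : D.-1 ^ 2 <= #|P| -> n ^ 2 <= (3 * K) ^ 2 * #|P|.
  move=> h; apply: leq_trans (leq_mul (leqnn _) h); rewrite -expnMn.
  by rewrite leq_exp2r.
apply: (@ties_le n M D _ KD m) => //; first by lia.
- move=> z zn; apply: few1; first by lia.
  (* The inequalities in [inner] are strict: the square starts at [z.+1] and has side [D.-1]. *)
  apply/nc/(@card_rectangle_ge _ _ z.+1 z.+1); rewrite ?addSnnS ?prednK //; try lia.
  by move=> x h1 h2; rewrite /= /inner; lia.
- apply: few2; first by lia.
  apply/nc; apply: leq_trans (_ : D ^ 2 <= _); first by rewrite leq_exp2r // leq_pred.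
  have Dn : D <= n by nia.
  (* Cell 0 alone is large enough. *)
  apply: (@card_rectangle_ge _ _ 0 (n - D)); try lia.
  move=> x /= h1 h2; rewrite /celled /= !divn_small //; lia.
Qed.

(** * Transfer to sequences *)

Section Encoding.
Variable n : nat.

Let position : finType := ('I_(n./2) + 'I_(n./2) + 'I_(odd n))%type.

Let card_position : #|position| = n.
Proof. by rewrite !card_sum !card_ord addnn addnC odd_double_half. Qed.

Let index (x : position) : 'I_n := cast_ord card_position (enum_rank x).

Let index_bij : bijective index.
Proof.
exists (fun i => enum_val (cast_ord (esym card_position) i)) => [x|i].
  by rewrite cast_ordK enum_rankK.
by rewrite /index enum_valK cast_ordKV.
Qed.

Definition pairing (A : faces n) : pdie n :=
  ([ffun k => (A (index (inl (inl k))), A (index (inl (inr k))))],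
   [ffun j => A (index (inr j))]).

Lemma pairing_bij : bijective pairing.
Proof.
have [inv indexK invK] := index_bij.
exists (fun p : pdie n => [ffun i => match inv i with
  | inl (inl k) => (p.1 k).1
  | inl (inr k) => (p.1 k).2
  | inr j => p.2 j
  end]).
- move=> A; apply/ffunP => i; rewrite !ffunE -[in RHS](invK i).
  by case: (inv i) => [[k|k]|j]; rewrite /= !ffunE.
- move=> [p r]; congr pair; apply/ffunP => k; rewrite !ffunE !indexK //=.
  by case: (p k).
Qed.

Lemma psum_pairing (f : 'I_n -> int) A : psum f (pairing A) = (\sum_i f (A i))%R.
Proof.
rewrite (reindex index) /=; last exact: onW_bij.
rewrite !big_sumType /= -big_split /=; congr (_ + _)%R.
  by apply: eq_bigr => k _; rewrite ffunE.
by apply: eq_bigr => j _; rewrite ffunE.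
Qed.

Lemma pairing_dice A : (pairing A \in pdice n) = (A \in dice n).
Proof.
rewrite !inE psum_pairing /face -(big_morph Posz PoszD (erefl _)) eqz_nat.
under [in RHS]eq_bigr do rewrite -addn1.
rewrite big_split /= sum_nat_const card_ord.
have -> : n * n.+1 %/ 2 = n * n.-1 %/ 2 + n * 1.
  by rewrite addnC muln1 -divnMDl //; congr (_ %/ _); nia.
by rewrite eqn_add2r.
Qed.

(** Sorting the pairs of faces by the face of [B], the two counts differ by the sum of the scores,
    up to sign. *)
Lemma pairing_ties A B : ties A B = ptie (pairing A) (pairing B).
Proof.
have cnt (R : rel nat) : Posz #|[set x : 'I_n * 'I_n | R (A x.1) (B x.2)]|
    = (\sum_(j < n) \sum_(i < n) Posz (R (A i) (B j)))%R.
  rewrite exchange_big /= pair_bigA /= -sum1_card (big_morph Posz PoszD (erefl _)).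
  rewrite big_mkcond /=; apply: eq_bigr => x _; rewrite inE.
  by case: (R _ _).
rewrite /ties /ptie psum_pairing -eqz_nat.
rewrite (cnt (fun a b => b.+1 < a.+1)) (cnt (fun a b => a.+1 < b.+1)).
rewrite -subr_eq0 -oppr_eq0 opprB -sumrB; congr (_ == _).
apply: eq_bigr => j _; rewrite /score psum_pairing -sumrB.
by apply: eq_bigr => i _.
Qed.

End Encoding.

Lemma tie_probabilityE (R : realType) n : (tie_probability R n =
  (\sum_(p in pdice n) \sum_(q in pdice n) ptie p q)%:R / (#|pdice n| ^ 2)%:R)%R.
Proof.
have cardE : #|pdice n| = #|dice n|.
  rewrite -!sum1_card (reindex _ (onW_bij _ (pairing_bij n))) /=.
  by apply: eq_bigl => A; rewrite pairing_dice.
rewrite /tie_probability natrX expr2 cardE natr_sum mulr_suml.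
rewrite (reindex _ (onW_bij _ (pairing_bij n))) /= [RHS]big_mkcond /=.
apply: eq_bigr => A _; rewrite pairing_dice /die_pmf.
case: (A \in dice n); last by rewrite big1 // => B _; rewrite mul0r.
rewrite (reindex _ (onW_bij _ (pairing_bij n))) /= natr_sum mulr_suml.
rewrite big_mkcond [RHS]big_mkcond; apply: eq_bigr => B _.
rewrite pairing_dice pairing_ties; case: (B \in dice n).
  by case: ptie; rewrite ?mul0r // mul1r invfM.
by case: ptie; rewrite ?mulr0.
Qed.

Local Open Scope classical_set_scope.
Local Open Scope ring_scope.

Theorem theorem1p4 (R : realType) :
  tie_probability R n @[n --> \oo] --> (0 : R).
Proof.
apply/cvgrPdist_le => /= e e0.
(* Ties will have probability at most [4 / M.+1]. *)
have [M Me] : exists M, 4 / e <= M.+1%:R.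
  exists (Num.truncn (4 / e)); exact/ltW/truncnS_gt.
have [n0 n0P] := ties_negligible M.
exists n0 => // n /= n0n.
rewrite sub0r normrN tie_probabilityE ger0_norm ?divr_ge0 //.
(* If there were no dice, the quotient would be 0 by the convention on the inverse of 0. *)
have [->|P0] := posnP #|pdice n|; first by rewrite invr0 mulr0 ltW.
rewrite ler_pdivrMr ?ltr0n ?expn_gt0 ?P0 //.
rewrite -(@ler_pM2l _ M.+1%:R) ?ltr0n // -natrM.
apply: le_trans (_ : (4 * #|pdice n| ^ 2)%N%:R <= _).
  by rewrite ler_nat; apply: n0P.
rewrite natrM mulrA ler_wpM2r //.
by rewrite -ler_pdivrMr.
Qed.
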